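(* Let $A$ be a weakly amenable Banach algebra. Suppose that for every closed two-sided ideal $I$ of $A$ such that $I$ equals the closed linear span of $\{ai : a\in A,\ i\in I\}\cup\{ia : a\in A,\ i\in I\}$, the algebra $A$ is $I$-weakly amenable. Then $A$ is ideally amenable.
   Context: For a Banach $A$-bimodule $X$ (jointly continuous module operations), the dual $X^*$ is a Banach $A$-bimodule via $\langle x,a\cdot x^*\rangle=\langle x\cdot a,x^*\rangle$ and $\langle x,x^*\cdot a\rangle=\langle a\cdot x,x^*\rangle$. A derivation $D:A\to X$ is a continuous linear map with $D(ab)=a\cdot D(b)+D(a)\cdot b$ for all $a,b\in A$; it is inner if there is $x\in X$ with $D(a)=a\cdot x-x\cdot a$ for all $a\in A$. $H^1(A,X)=\{0\}$ means every derivation $A\to X$ is inner. $A$ is weakly amenable if $H^1(A,A^* )=\{0\}$. For a closed two-sided ideal $I$ of $A$ (a Banach $A$-bimodule under multiplication), $A$ is $I$-weakly amenable if $H^1(A,I^* )=\{0\}$. $A$ is ideally amenable if it is $I$-weakly amenable for every closed two-sided ideal $I$ of $A$. *)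

(* Defs.v *)
From HB Require Import structures.
From mathcomp Require Import all_boot all_order all_algebra ring.
From mathcomp Require Import complex.
From mathcomp Require Import all_classical all_reals all_analysis.

Set Implicit Arguments.
Unset Strict Implicit.
Unset Printing Implicit Defensive.

Import Order.TTheory GRing.Theory Num.Theory.
Import numFieldNormedType.Exports.

Local Open Scope classical_set_scope.
Local Open Scope ring_scope.
Local Open Scope complex_scope.

(* Banach algebras need not be unital, so they cannot be built on the ring
   structures of the algebra library. *)
HB.mixin Record CompleteNormedModule_isBanachAlgebra (K : numFieldType) A
    & CompleteNormedModule K A := {
  amul : A -> A -> A ;
  amulA : associative amul ;
  amul_linearl : forall b, linear (amul^~ b) ;
  amul_linearr : forall a, linear (amul a) ;
  amul_norm_le : forall a b, `|amul a b| <= `|a| * `|b|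
}.

#[short(type="banachAlgType")]
HB.structure Definition BanachAlgebra (K : numFieldType) :=
  {A of CompleteNormedModule K A & CompleteNormedModule_isBanachAlgebra K A}.

Record banach_bimodule (K : numFieldType) (A : banachAlgType K) :=
  BanachBimodule {
  bimod_space :> completeNormedModType K ;
  lact : A -> bimod_space -> bimod_space ;
  ract : bimod_space -> A -> bimod_space ;
  lact_linearl : forall x, linear (lact^~ x) ;
  lact_linearr : forall a, linear (lact a) ;
  ract_linearl : forall a, linear (ract^~ a) ;
  ract_linearr : forall x, linear (ract x) ;
  lactA : forall a b x, lact (amul a b) x = lact a (lact b x) ;
  ractA : forall x a b, ract x (amul a b) = ract (ract x a) b ;
  lractA : forall a x b, ract (lact a x) b = lact a (ract x b) ;
  lact_continuous : continuous (fun z : A * bimod_space => lact z.1 z.2) ;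
  ract_continuous : continuous (fun z : bimod_space * A => ract z.1 z.2)
}.

Section bilinear_bounded.
Context {K : numFieldType} {U V W : normedModType K} (m : U -> V -> W).
Hypothesis ml : forall v, linear (m^~ v).
Hypothesis mr : forall u, linear (m u).

Let m0v v : m 0 v = 0.
Proof.
by have := ml v 1 0 0; rewrite scale1r addr0 scale1r => /eqP;
   rewrite -subr_eq0 opprD addrA subrr sub0r oppr_eq0 => /eqP.
Qed.

Let mu0 u : m u 0 = 0.
Proof.
by have := mr u 1 0 0; rewrite scale1r addr0 scale1r => /eqP;
   rewrite -subr_eq0 opprD addrA subrr sub0r oppr_eq0 => /eqP.
Qed.

Let mZv k u v : m (k *: u) v = k *: m u v.
Proof. by have := ml v k u 0; rewrite addr0 m0v addr0. Qed.

Let muZ k u v : m u (k *: v) = k *: m u v.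
Proof. by have := mr u k v 0; rewrite addr0 mu0 addr0. Qed.

Let mBv u u' v : m (u - u') v = m u v - m u' v.
Proof. by rewrite -scaleN1r addrC ml scaleN1r addrC. Qed.

Let muB u v v' : m u (v - v') = m u v - m u v'.
Proof. by rewrite -scaleN1r addrC mr scaleN1r addrC. Qed.

Lemma bilinear_continuous_bounded :
  continuous (fun z : U * V => m z.1 z.2) ->
  exists2 M : K, 0 <= M & forall u v, `|m u v| <= M * `|u| * `|v|.
Proof.
move=> mc.
have /cvgrPdist_lt /(_ 1 ltr01) := mc (0, 0).
rewrite /= m0v => /nbhs_ballP[d /= d0 md].
have d20 : 0 < d / 2 by rewrite divr_gt0.
exists ((d / 2)^-1 ^+ 2); first by rewrite exprn_ge0// invr_ge0 ltW.
move=> u v.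
have [->|u0] := eqVneq u 0; first by rewrite m0v !normr0 mulr0 mul0r.
have [->|v0] := eqVneq v 0; first by rewrite mu0 !normr0 mulr0.
have nu : 0 < `|u| by rewrite normr_gt0.
have nv : 0 < `|v| by rewrite normr_gt0.
have small (T : normedModType K) (t : T) : 0 < `|t| ->
    `|0 - (d / 2 / `|t|) *: t| < d.
  move=> t0; rewrite sub0r normrN normrZ ger0_norm ?divr_ge0 ?ltW//.
  by rewrite divfK ?gt_eqF// ltr_pdivrMr// ltr_pMr// ltr1n.
have := md ((d / 2 / `|u|) *: u, (d / 2 / `|v|) *: v).
have bx : ball ((0, 0) : U * V) d
    ((d / 2 / `|u|) *: u, (d / 2 / `|v|) *: v).
  by split; rewrite -ball_normE /=; exact: small.
move=> /(_ bx); rewrite /= mZv muZ scalerA sub0r normrN normrZ.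
rewrite ger0_norm ?mulr_ge0 ?divr_ge0 ?(ltW d0) ?(ltW nu) ?(ltW nv)//.
move=> /ltW; rewrite mulrC -ler_pdivlMr ?mulr_gt0 ?divr_gt0 ?invr_gt0//.
move=> /le_trans; apply.
rewrite le_eqVlt; apply/orP; left; apply/eqP; field.
by rewrite !gt_eqF.
Qed.

Lemma bilinear_bounded_continuous (M : K) :
  0 <= M -> (forall u v, `|m u v| <= M * `|u| * `|v|) ->
  continuous (fun z : U * V => m z.1 z.2).
Proof.
move=> M0 mM [u v]; apply/cvgrPdist_lt => e e0 /=.
have M1 : 0 < M + 1 by rewrite ltr_wpDl.
have cu : 0 < `|u| + 1 by rewrite ltr_wpDl.
have cv : 0 < `|v| + 1 by rewrite ltr_wpDl.
have e1 : 0 < e / 2 / (M + 1) / (`|v| + 1) by rewrite !divr_gt0.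
have e2 : 0 < e / 2 / (M + 1) / (`|u| + 1) by rewrite !divr_gt0.
near=> z.
have -> : m u v - m z.1 z.2 = m (u - z.1) z.2 + m u (v - z.2).
  by rewrite mBv muB [RHS]addrC addrA subrK.
have z2 : `|z.2| <= `|v| + 1.
  rewrite -[z.2](subrK v) addrC (le_trans (ler_normD _ _))// lerD2l distrC.
  by apply/ltW; near: z; apply: cvgr_dist_lt => //; exact: cvg_snd.
have le1 : `|u - z.1| <= e / 2 / (M + 1) / (`|v| + 1).
  by apply/ltW; near: z; apply: cvgr_dist_lt => //; exact: cvg_fst.
have lt2 : `|v - z.2| <= e / 2 / (M + 1) / (`|u| + 1).
  by apply/ltW; near: z; apply: cvgr_dist_lt => //; exact: cvg_snd.
have Mlt : M / (M + 1) < 1 by rewrite ltr_pdivrMr// mul1r ltrDl.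
apply: le_lt_trans (ler_normD _ _) _; rewrite [e]splitr.
have half : e / 2 * (M / (M + 1)) < e / 2.
  by rewrite gtr_pMr// divr_gt0.
apply: ltrD; apply: le_lt_trans (mM _ _) (le_lt_trans _ half).
  apply: (@le_trans _ _ (M * (e / 2 / (M + 1) / (`|v| + 1)) * (`|v| + 1))).
    by rewrite ler_pM ?mulr_ge0 ?ler_wpM2l.
  rewrite le_eqVlt; apply/orP; left; apply/eqP; field.
  by rewrite !gt_eqF.
apply: (@le_trans _ _ (M * (`|u| + 1) * (e / 2 / (M + 1) / (`|u| + 1)))).
  by rewrite ler_pM ?mulr_ge0 ?ler_wpM2l ?lerDl.
rewrite le_eqVlt; apply/orP; left; apply/eqP; field.
by rewrite !gt_eqF.
Unshelve. all: by end_near. Qed.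

End bilinear_bounded.

Record closed_ideal (K : numFieldType) (A : banachAlgType K) := ClosedIdeal {
  ideal_set :> set A ;
  ideal0 : ideal_set 0 ;
  ideal_linear : forall (k : K) x y,
    ideal_set x -> ideal_set y -> ideal_set (k *: x + y) ;
  ideal_mull : forall a x, ideal_set x -> ideal_set (amul a x) ;
  ideal_mulr : forall a x, ideal_set x -> ideal_set (amul x a) ;
  ideal_closed : closed ideal_set
}.

Section ideal_space.
Context {K : numFieldType} {A : banachAlgType K} (I : closed_ideal A).

Record ideal_space := IdealSpace {
  ideal_val : A ;
  ideal_valP : ideal_val \in (I : set A)
}.

HB.instance Definition _ := [isSub for ideal_val].
HB.instance Definition _ := [Choice of ideal_space by <:].

Let ideal_submod_closed : submod_closed (fun x : A => x \in (I : set A)).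
Proof.
split=> [|k x y]; first exact/mem_set/ideal0.
by move=> /set_mem Ix /set_mem Iy; exact/mem_set/ideal_linear.
Qed.

HB.instance Definition _ :=
  GRing.SubChoice_isSubLmodule.Build K A (fun x => x \in (I : set A)) ideal_space
    (GRing.submod_closed_semi ideal_submod_closed).

Let ideal_norm (x : ideal_space) : K := `|ideal_val x|.

Let ideal_normD x y : ideal_norm (x + y) <= ideal_norm x + ideal_norm y.
Proof. exact: ler_normD. Qed.

Let ideal_normZ (k : K) x : ideal_norm (k *: x) = `|k| * ideal_norm x.
Proof. exact: normrZ. Qed.

Let ideal_norm0_eq0 x : ideal_norm x = 0 -> x = 0.
Proof. by move=> /normr0_eq0 x0; apply: val_inj; rewrite /= x0. Qed.

HB.instance Definition _ :=
  Lmodule_isNormed.Build K ideal_space ideal_normD ideal_normZ ideal_norm0_eq0.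

Lemma ideal_normE (x : ideal_space) : `|x| = `|ideal_val x|.
Proof. by []. Qed.

Lemma ideal_val_linear : linear ideal_val.
Proof. by []. Qed.

Let ideal_complete (F : set_system ideal_space) :
  ProperFilter F -> cauchy F -> cvg F.
Proof.
move=> FF /cauchyP Fc.
have /cauchy_cvg /cvg_ex[l Fl] : cauchy (ideal_val @ F).
  apply/cauchyP => e /Fc[x Fx]; exists (ideal_val x).
  by rewrite -ball_normE in Fx; rewrite /= -ball_normE; exact: Fx.
have Il : (I : set A) l.
  apply: (@ideal_closed _ _ I).
  move=> B /Fl /= FB; have [x Bx] := @filter_ex _ F _ _ FB.
  by exists (ideal_val x); split => //; exact/set_mem/ideal_valP.
apply/cvg_ex; exists (IdealSpace (mem_set Il)).
apply/cvgrPdist_lt => e e0.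
by have /cvgrPdist_lt /(_ _ e0) := Fl.
Qed.

HB.instance Definition _ := Uniform_isComplete.Build ideal_space ideal_complete.

End ideal_space.

Section dual_space_theory.
Context {R : realType} {X : normedModType R[i]}.

Record dual_space := DualFunctional {
  dual_fun :> X -> R[i]^o ;
  dual_linear : linear dual_fun ;
  dual_continuous : continuous dual_fun
}.

HB.instance Definition _ := gen_eqMixin dual_space.
HB.instance Definition _ := gen_choiceMixin dual_space.

HB.instance Definition _ (f : dual_space) :=
  GRing.isLinear.Build R[i] X R[i]^o _ (dual_fun f) (dual_linear f).

Lemma dualP (f g : dual_space) : f =1 g -> f = g.
Proof.
case: f g => [f fl fc] [g gl gc] /= fg.
have {}fg : f = g by exact/funext.
by subst g; congr DualFunctional; exact: Prop_irrelevance.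
Qed.

Let zero_linear : linear (fun _ : X => 0 : R[i]^o).
Proof. by move=> k x y; rewrite scaler0 addr0. Qed.

Let zero_continuous : continuous (fun _ : X => 0 : R[i]^o).
Proof. by move=> x; exact: cvg_cst. Qed.

Let add_linear (f g : dual_space) : linear (fun x => f x + g x).
Proof. by move=> k x y; rewrite !linearP scalerDr addrACA. Qed.

Let add_continuous (f g : dual_space) : continuous (fun x => f x + g x).
Proof. by move=> x; apply: cvgD; exact: dual_continuous. Qed.

Let scale_linear (k : R[i]) (f : dual_space) : linear (fun x => k *: f x).
Proof.
by move=> c x y; rewrite linearP scalerDr !scalerA [k * c]mulrC.
Qed.

Let scale_continuous (k : R[i]) (f : dual_space) : continuous (fun x => k *: f x).
Proof. by move=> x; apply: cvgZl_tmp; exact: dual_continuous. Qed.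

Definition dual_zero := DualFunctional zero_linear zero_continuous.
Definition dual_add f g := DualFunctional (@add_linear f g) (@add_continuous f g).
Definition dual_scale k f := DualFunctional (@scale_linear k f) (@scale_continuous k f).
Definition dual_opp f := dual_scale (-1) f.

Let dual_addA : associative dual_add.
Proof. by move=> f g h; apply: dualP => x /=; rewrite addrA. Qed.
Let dual_addC : commutative dual_add.
Proof. by move=> f g; apply: dualP => x /=; rewrite addrC. Qed.
Let dual_add0 : left_id dual_zero dual_add.
Proof. by move=> f; apply: dualP => x /=; rewrite add0r. Qed.
Let dual_addN : left_inverse dual_zero dual_opp dual_add.
Proof. by move=> f; apply: dualP => x /=; rewrite scaleN1r addNr. Qed.

HB.instance Definition _ :=
  GRing.isZmodule.Build dual_space dual_addA dual_addC dual_add0 dual_addN.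

Let dual_scaleA a b f : dual_scale a (dual_scale b f) = dual_scale (a * b) f.
Proof. by apply: dualP => x /=; rewrite scalerA. Qed.
Let dual_scale1 : left_id 1 dual_scale.
Proof. by move=> f; apply: dualP => x /=; rewrite scale1r. Qed.
Let dual_scaleDr : right_distributive dual_scale +%R.
Proof. by move=> k f g; apply: dualP => x /=; rewrite scalerDr. Qed.
Let dual_scaleDl f : {morph dual_scale^~ f : a b / a + b}.
Proof. by move=> a b; apply: dualP => x /=; rewrite scalerDl. Qed.

HB.instance Definition _ := GRing.Zmodule_isLmodule.Build R[i] dual_space
  dual_scaleA dual_scale1 dual_scaleDr dual_scaleDl.

Lemma dual_addE (f g : dual_space) x : (f + g) x = f x + g x.
Proof. by []. Qed.

Lemma dual_scaleE k (f : dual_space) x : (k *: f) x = k *: f x.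
Proof. by []. Qed.

Lemma dual_oppE (f : dual_space) x : (- f) x = - f x.
Proof. by rewrite /= scaleN1r. Qed.

(* Norms over R[i] are R[i]-valued (with null imaginary part), hence [Re]. *)
Definition opnorm (f : dual_space) : R :=
  sup [set complex.Re `|f x| | x in [set x : X | `|x| <= 1]].

Let normReE (z : R[i]^o) : (complex.Re `|z|)%:C = `|z|.
Proof. by rewrite RRe_real// normr_real. Qed.

Lemma dual_bounded (f : dual_space) :
  exists2 M : R[i], 0 < M & forall x, `|f x| <= M * `|x|.
Proof.
have /linear_boundedP /pinfty_ex_gt0[M M0 fM] : bounded_near f (nbhs 0).
  by apply: continuous_linear_bounded; exact: dual_continuous.
by exists M.
Qed.

Let opnorm_has_sup (f : dual_space) :
  has_sup [set complex.Re `|f x| | x in [set x : X | `|x| <= 1]].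
Proof.
split; first by exists (complex.Re `|f 0|), 0 => //=; rewrite normr0.
have [M M0 fM] := dual_bounded f; exists (complex.Re M) => _ [x /= x1 <-].
rewrite -lecR normReE RRe_real ?gtr0_real//.
by rewrite (le_trans (fM x))// ler_piMr// ltW.
Qed.

Lemma opnorm_bound (f : dual_space) x : `|f x| <= (opnorm f)%:C * `|x|.
Proof.
have [->|x0] := eqVneq x 0; first by rewrite linear0 !normr0 mulr0.
have nx : 0 < `|x| by rewrite normr_gt0.
rewrite -ler_pdivrMr//.
have -> : `|f x| / `|x| = `|f (`|x|^-1 *: x)|.
  by rewrite linearZ normrZ ger0_norm ?invr_ge0// mulrC.
rewrite -normReE lecR; apply: sup_upper_bound => //.
exists (`|x|^-1 *: x) => //=.
by rewrite normrZ ger0_norm ?invr_ge0// mulVf ?gt_eqF.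
Qed.

Lemma opnorm_le (f : dual_space) (M : R[i]) :
  0 <= M -> (forall x, `|f x| <= M * `|x|) -> (opnorm f)%:C <= M.
Proof.
move=> M0 fM; rewrite -(RRe_real (ger0_real M0)) lecR.
apply: ge_sup; first by case: (opnorm_has_sup f).
move=> _ [x /= x1 <-]; rewrite -lecR normReE RRe_real ?ger0_real//.
by rewrite (le_trans (fM x))// ler_piMr.
Qed.

Lemma opnorm_ge0 (f : dual_space) : 0 <= (opnorm f)%:C.
Proof.
rewrite ler0c; apply: (le_trans _ (sup_upper_bound (opnorm_has_sup f) _)).
  exact: lexx.
exists 0; first by rewrite /= normr0.
by rewrite linear0 (@normr0 _ R[i]^o).
Qed.

Let dual_norm (f : dual_space) : R[i] := (opnorm f)%:C.

Let dual_normD f g : dual_norm (f + g) <= dual_norm f + dual_norm g.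
Proof.
apply: opnorm_le => [|x]; first by rewrite addr_ge0 ?opnorm_ge0.
by rewrite mulrDl (le_trans (ler_normD _ _))// lerD// opnorm_bound.
Qed.

Let dual_normZ_le (k : R[i]) f : dual_norm (k *: f) <= `|k| * dual_norm f.
Proof.
apply: opnorm_le => [|x]; first by rewrite mulr_ge0 ?opnorm_ge0.
by rewrite dual_scaleE normrZ -mulrA ler_wpM2l// opnorm_bound.
Qed.

Let dual_normZ (k : R[i]) f : dual_norm (k *: f) = `|k| * dual_norm f.
Proof.
apply/le_anti; rewrite dual_normZ_le/=.
have [->|k0] := eqVneq k 0; first by rewrite normr0 mul0r opnorm_ge0.
rewrite -ler_pdivlMl ?normr_gt0// -normfV.
by rewrite (le_trans _ (dual_normZ_le _ _))// scalerA mulVf// scale1r.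
Qed.

Let dual_norm0_eq0 f : dual_norm f = 0 -> f = 0.
Proof.
move=> f0; apply: dualP => x /=; apply/normr0_eq0/le_anti.
by rewrite normr_ge0 andbT (le_trans (opnorm_bound f x))// -/(dual_norm f) f0 mul0r.
Qed.

HB.instance Definition _ :=
  Lmodule_isNormed.Build R[i] dual_space dual_normD dual_normZ dual_norm0_eq0.

Lemma dual_normE (f : dual_space) : `|f| = (opnorm f)%:C.
Proof. by []. Qed.

End dual_space_theory.
Arguments dual_space {R} X.

Section complex_complete.
Context {R : realType}.

Let RRe_ge0 (z : R[i]) : 0 <= z -> (complex.Re z)%:C = z.
Proof. by move=> z0; rewrite RRe_real// ger0_real. Qed.

Let ReB (z w : R[i]) : complex.Re (z - w) = complex.Re z - complex.Re w.
Proof. by case: z w => a b [c d]. Qed.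

Let ImB (z w : R[i]) : complex.Im (z - w) = complex.Im z - complex.Im w.
Proof. by case: z w => a b [c d]. Qed.

Let normRe_le (z : R[i]) : `|complex.Re z|%:C <= `|z|.
Proof.
rewrite normc_def lecR -sqrtr_sqr ler_sqrt ?addr_ge0 ?sqr_ge0//.
by rewrite lerDl sqr_ge0.
Qed.

Let normIm_le (z : R[i]) : `|complex.Im z|%:C <= `|z|.
Proof.
rewrite normc_def lecR -sqrtr_sqr ler_sqrt ?addr_ge0 ?sqr_ge0//.
by rewrite lerDr sqr_ge0.
Qed.

Let norm_le_ReIm (z : R[i]) :
  `|z| <= `|complex.Re z|%:C + `|complex.Im z|%:C.
Proof.
have nr (a : R) : `|a%:C| = `|a|%:C.
  by rewrite normc_def /= expr0n/= addr0 sqrtr_sqr.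
rewrite {1}[z]complexE (le_trans (ler_normD _ _))// nr normrM nr.
have -> : `|'i%C : R[i]| = 1.
  by rewrite normc_def /= expr0n/= add0r expr1n sqrtr1.
by rewrite mul1r.
Qed.

Lemma complex_cauchy_cvg (F : set_system R[i]^o) :
  ProperFilter F -> cauchy F -> cvg F.
Proof.
move=> FF /cauchyP Fc.
have FRe : cauchy ((fun z : R[i]^o => complex.Re z) @ F).
  apply/cauchyP => e e0; have [|z] := Fc e%:C; first by rewrite ltcR.
  rewrite -ball_normE => Fz; exists (complex.Re z).
  apply: (@filterS _ F _ _ _ _ Fz) => w /= zw; rewrite -ball_normE /= -ltcR.
  by apply: le_lt_trans zw; have := normRe_le (z - w); rewrite ReB.
have FIm : cauchy ((fun z : R[i]^o => complex.Im z) @ F).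
  apply/cauchyP => e e0; have [|z] := Fc e%:C; first by rewrite ltcR.
  rewrite -ball_normE => Fz; exists (complex.Im z).
  apply: (@filterS _ F _ _ _ _ Fz) => w /= zw; rewrite -ball_normE /= -ltcR.
  by apply: le_lt_trans zw; have := normIm_le (z - w); rewrite ImB.
have /cvg_ex[a Fa] : cvg ((fun z : R[i]^o => complex.Re z) @ F).
  exact: cauchy_cvg.
have /cvg_ex[b Fb] : cvg ((fun z : R[i]^o => complex.Im z) @ F).
  exact: cauchy_cvg.
apply/cvg_ex; exists (a +i* b : R[i]^o); apply/cvgrPdist_lt => e e0.
have e20 : 0 < e / 2 by rewrite divr_gt0.
have er : (complex.Re (e / 2))%:C = e / 2 by rewrite RRe_ge0 ?ltW.
have er0 : 0 < complex.Re (e / 2) by rewrite -ltcR er.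
have /cvgrPdist_lt /(_ _ er0) Fa' := Fa.
have /cvgrPdist_lt /(_ _ er0) Fb' := Fb.
near=> z.
apply: le_lt_trans (norm_le_ReIm _) _; rewrite [e]splitr -er.
apply: ltrD; rewrite ltcR.
  by rewrite ReB; near: z; exact: Fa'.
by rewrite ImB; near: z; exact: Fb'.
Unshelve. all: by end_near. Qed.

End complex_complete.

Section dual_complete.
Context {R : realType} {X : normedModType R[i]}.

Lemma dual_cauchy_cvg (F : set_system (dual_space X)) :
  ProperFilter F -> cauchy F -> cvg F.
Proof.
move=> FF /cauchyP Fc.
have Fx x : cvg ((fun f : dual_space X => f x) @ F).
  apply: complex_cauchy_cvg; apply/cauchyP => e e0.
  have x1 : 0 < `|x| + 1 by rewrite ltr_wpDl.
  have [|f] := Fc (e / (`|x| + 1)); first by rewrite divr_gt0.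
  rewrite -ball_normE => Ff; exists (f x).
  apply: (@filterS _ F _ _ _ _ Ff) => g /= fg.
  rewrite -ball_normE /=.
  rewrite -dual_oppE -dual_addE (le_lt_trans (opnorm_bound _ _))//.
  rewrite -dual_normE (@le_lt_trans _ _ (`|f - g| * (`|x| + 1)))//.
    by rewrite ler_wpM2l// lerDl.
  by rewrite -ltr_pdivlMr.
pose l x : R[i]^o := lim ((fun f : dual_space X => f x) @ F).
have lx x : (fun f : dual_space X => f x) @ F --> l x by exact: Fx.
have ll : linear l.
  move=> k x y; apply: (cvg_lim (@norm_hausdorff R[i] R[i]^o)).
  have -> : (fun f : dual_space X => f (k *: x + y)) = (fun f => k *: f x + f y).
    by apply/funext => f; rewrite linearP.
  by apply: cvgD; [apply: cvgZl_tmp|]; exact: lx.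
have lF (g : dual_space X) e : 0 < e -> F (ball g e) ->
    forall x, `|l x - g x| <= e * `|x|.
  move=> e0 Fg x; apply/ler_addgt0Pr => d d0.
  have /cvgrPdist_lt /(_ _ d0) Fd := lx x.
  have [f [fg lf]] := filter_ex (filterI Fg Fd).
  rewrite -[l x](subrK (f x)) -addrA (le_trans (ler_normD _ _))//.
  rewrite [leRHS]addrC; apply: lerD; first exact/ltW.
  rewrite -dual_oppE -dual_addE (le_trans (opnorm_bound _ _))// ler_wpM2r//.
  by rewrite -dual_normE distrC; move: fg; rewrite -ball_normE => /ltW.
have lc : continuous l.
  pose L := GRing.isLinear.Build R[i] X R[i]^o _ l ll.
  pose l' : {linear X -> R[i]^o} := HB.pack l L.
  rewrite -[l]/(l' : X -> R[i]^o).
  have [g Fg] := Fc 1 ltr01.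
  apply: bounded_linear_continuous; apply/linear_boundedP.
  have M0 : 0 <= 1 + `|g| by rewrite addr_ge0.
  near=> r => x.
  apply: (@le_trans _ _ ((1 + `|g|) * `|x|)); last first.
    rewrite ler_wpM2r//; near: r; exact: nbhs_pinfty_ge (ger0_real M0).
  rewrite -[l' x](subrK (g x)) (le_trans (ler_normD _ _))// mulrDl.
  by rewrite lerD ?opnorm_bound// lF.
apply/cvg_ex; exists (DualFunctional ll lc); apply/cvgrPdist_lt => e e0.
have e40 : 0 < e / 2 by rewrite divr_gt0.
have [g Fg] := Fc _ e40.
have Lg : `|DualFunctional ll lc - g| <= e / 2.
  rewrite dual_normE; apply: opnorm_le => [|x]; first exact: ltW.
  by rewrite dual_addE dual_oppE; exact: lF.
apply: filterS Fg => f; rewrite -ball_normE /= => gf.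
rewrite -[X in X - f](subrK g) -addrA (le_lt_trans (ler_normD _ _))//.
by rewrite [e]splitr ler_ltD.
Unshelve. all: by end_near. Qed.

HB.instance Definition _ := Uniform_isComplete.Build (dual_space X) dual_cauchy_cvg.

End dual_complete.

Section dual_bimodule.
Context {R : realType} {A : banachAlgType R[i]} (X : banach_bimodule A).

Let dual_lact_linear (a : A) (f : dual_space X) : linear (fun x => f (ract x a)).
Proof. by move=> k x y; rewrite ract_linearl linearP. Qed.

Let dual_lact_continuous (a : A) (f : dual_space X) :
  continuous (fun x => f (ract x a)).
Proof.
move=> x; apply: (@continuous_comp _ _ _ (fun x => ract x a) f);
  last exact: dual_continuous.
apply: (@continuous_comp _ _ _ (fun x => (x, a)) (fun z => ract z.1 z.2)).
  by apply: cvg_pair => /=; [exact: cvg_id|exact: cvg_cst].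
exact: ract_continuous.
Qed.

Let dual_ract_linear (f : dual_space X) (a : A) : linear (fun x => f (lact a x)).
Proof. by move=> k x y; rewrite lact_linearr linearP. Qed.

Let dual_ract_continuous (f : dual_space X) (a : A) :
  continuous (fun x => f (lact a x)).
Proof.
move=> x; apply: (@continuous_comp _ _ _ (fun x => lact a x) f);
  last exact: dual_continuous.
apply: (@continuous_comp _ _ _ (fun x => (a, x)) (fun z => lact z.1 z.2)).
  by apply: cvg_pair => /=; [exact: cvg_cst|exact: cvg_id].
exact: lact_continuous.
Qed.

(* <x, a . f> = <x . a, f> and <x, f . a> = <a . x, f> *)
Definition dual_lact (a : A) (f : dual_space X) : dual_space X :=
  DualFunctional (@dual_lact_linear a f) (@dual_lact_continuous a f).

Definition dual_ract (f : dual_space X) (a : A) : dual_space X :=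
  DualFunctional (@dual_ract_linear f a) (@dual_ract_continuous f a).

Let dual_lact_linearl f : linear (dual_lact^~ f).
Proof.
move=> k a b; apply: dualP => x.
by rewrite dual_addE dual_scaleE /= ract_linearr linearP.
Qed.

Let dual_lact_linearr a : linear (dual_lact a).
Proof. by move=> k f g; exact: dualP. Qed.

Let dual_ract_linearl a : linear (dual_ract^~ a).
Proof. by move=> k f g; exact: dualP. Qed.

Let dual_ract_linearr f : linear (dual_ract f).
Proof.
move=> k a b; apply: dualP => x.
by rewrite dual_addE dual_scaleE /= lact_linearl linearP.
Qed.

Let dual_lactA a b f :
  dual_lact (amul a b) f = dual_lact a (dual_lact b f).
Proof. by apply: dualP => x /=; rewrite ractA. Qed.

Let dual_ractA f a b :
  dual_ract f (amul a b) = dual_ract (dual_ract f a) b.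
Proof. by apply: dualP => x /=; rewrite lactA. Qed.

Let dual_lractA a f b :
  dual_ract (dual_lact a f) b = dual_lact a (dual_ract f b).
Proof. by apply: dualP => x /=; rewrite lractA. Qed.

Let dual_lact_jcontinuous :
  continuous (fun z : A * dual_space X => dual_lact z.1 z.2).
Proof.
have [M M0 rM] := bilinear_continuous_bounded (@ract_linearl _ _ X)
  (@ract_linearr _ _ X) (@ract_continuous _ _ X).
apply: (bilinear_bounded_continuous dual_lact_linearl dual_lact_linearr M0).
move=> a f; apply: opnorm_le => [|x]; first by rewrite !mulr_ge0.
rewrite /= (le_trans (opnorm_bound _ _))//.
apply: (le_trans (ler_wpM2l (opnorm_ge0 f) (rM x a))).
by rewrite le_eqVlt; apply/orP; left; apply/eqP; rewrite dual_normE; ring.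
Qed.

Let dual_ract_jcontinuous :
  continuous (fun z : dual_space X * A => dual_ract z.1 z.2).
Proof.
have [M M0 lM] := bilinear_continuous_bounded (@lact_linearl _ _ X)
  (@lact_linearr _ _ X) (@lact_continuous _ _ X).
apply: (bilinear_bounded_continuous dual_ract_linearl dual_ract_linearr M0).
move=> f a; apply: opnorm_le => [|x]; first by rewrite !mulr_ge0.
rewrite /= (le_trans (opnorm_bound _ _))//.
apply: (le_trans (ler_wpM2l (opnorm_ge0 f) (lM a x))).
by rewrite le_eqVlt; apply/orP; left; apply/eqP; rewrite dual_normE; ring.
Qed.

Definition dual_bimodule : banach_bimodule A :=
  @BanachBimodule R[i] A (dual_space X) dual_lact dual_ract
    dual_lact_linearl dual_lact_linearr dual_ract_linearl dual_ract_linearr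
    dual_lactA dual_ractA dual_lractA
    dual_lact_jcontinuous dual_ract_jcontinuous.

End dual_bimodule.

Section multiplication_bimodules.
Context {K : numFieldType} {A : banachAlgType K}.

Let amul_continuous : continuous (fun z : A * A => amul z.1 z.2).
Proof.
apply: (bilinear_bounded_continuous amul_linearl amul_linearr ler01).
by move=> a b; rewrite mul1r amul_norm_le.
Qed.

Definition regular_bimodule : banach_bimodule A :=
  @BanachBimodule K A A amul amul
    amul_linearl amul_linearr amul_linearl amul_linearr
    (fun a b x => esym (amulA a b x)) (fun x a b => amulA x a b)
    (fun a x b => esym (amulA a x b))
    amul_continuous amul_continuous.

Variable I : closed_ideal A.

Definition ideal_lact (a : A) (x : ideal_space I) : ideal_space I :=
  IdealSpace (mem_set (ideal_mull a (set_mem (ideal_valP x)))).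

Definition ideal_ract (x : ideal_space I) (a : A) : ideal_space I :=
  IdealSpace (mem_set (ideal_mulr a (set_mem (ideal_valP x)))).

Let ideal_lact_linearl x : linear (ideal_lact^~ x).
Proof. by move=> k a b; apply: val_inj; exact: amul_linearl. Qed.

Let ideal_lact_linearr a : linear (ideal_lact a).
Proof. by move=> k x y; apply: val_inj; exact: amul_linearr. Qed.

Let ideal_ract_linearl a : linear (ideal_ract^~ a).
Proof. by move=> k x y; apply: val_inj; exact: amul_linearl. Qed.

Let ideal_ract_linearr x : linear (ideal_ract x).
Proof. by move=> k a b; apply: val_inj; exact: amul_linearr. Qed.

Let ideal_lactA a b x : ideal_lact (amul a b) x = ideal_lact a (ideal_lact b x).
Proof. by apply: val_inj; rewrite /= amulA. Qed.

Let ideal_ractA x a b : ideal_ract x (amul a b) = ideal_ract (ideal_ract x a) b.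
Proof. by apply: val_inj; rewrite /= amulA. Qed.

Let ideal_lractA a x b :
  ideal_ract (ideal_lact a x) b = ideal_lact a (ideal_ract x b).
Proof. by apply: val_inj; rewrite /= amulA. Qed.

Let ideal_lact_continuous :
  continuous (fun z : A * ideal_space I => ideal_lact z.1 z.2).
Proof.
apply: (bilinear_bounded_continuous ideal_lact_linearl ideal_lact_linearr ler01).
by move=> a x; rewrite mul1r; exact: amul_norm_le.
Qed.

Let ideal_ract_continuous :
  continuous (fun z : ideal_space I * A => ideal_ract z.1 z.2).
Proof.
apply: (bilinear_bounded_continuous ideal_ract_linearl ideal_ract_linearr ler01).
by move=> x a; rewrite mul1r; exact: amul_norm_le.
Qed.

Definition ideal_bimodule : banach_bimodule A :=
  @BanachBimodule K A (ideal_space I) ideal_lact ideal_ract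
    ideal_lact_linearl ideal_lact_linearr
    ideal_ract_linearl ideal_ract_linearr
    ideal_lactA ideal_ractA ideal_lractA
    ideal_lact_continuous ideal_ract_continuous.

End multiplication_bimodules.
Arguments regular_bimodule {K} A.

Section amenability.
Context {K : numFieldType} {A : banachAlgType K} (X : banach_bimodule A).

Definition derivation (D : A -> X) :=
  [/\ linear D, continuous D &
      forall a b, D (amul a b) = lact a (D b) + ract (D a) b].

Definition inner_derivation (D : A -> X) :=
  exists x : X, forall a, D a = lact a x - ract x a.

Definition H1_trivial := forall D : A -> X, derivation D -> inner_derivation D.

End amenability.

Definition weakly_amenable {R : realType} (A : banachAlgType R[i]) :=
  H1_trivial (dual_bimodule (regular_bimodule A)).

Definition ideal_weakly_amenable {R : realType} (A : banachAlgType R[i])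
    (I : closed_ideal A) :=
  H1_trivial (dual_bimodule (ideal_bimodule I)).

Definition ideally_amenable {R : realType} (A : banachAlgType R[i]) :=
  forall I : closed_ideal A, ideal_weakly_amenable I.

Definition linear_span {K : numFieldType} {V : lmodType K} (S : set V) : set V :=
  [set v | exists n (c : 'I_n -> K) (s : 'I_n -> V),
     (forall i, S (s i)) /\ v = \sum_(i < n) c i *: s i].

Definition closed_linear_span {K : numFieldType} {V : normedModType K}
    (S : set V) : set V :=
  closure (linear_span S).

Definition ideal_products {K : numFieldType} {A : banachAlgType K}
    (I : set A) : set A :=
  [set amul a i | a in [set: A] & i in I] `|`
  [set amul i a | a in [set: A] & i in I].

(* Main.v *)
Require Import Defs.
From HB Require Import structures.
From mathcomp Require Import all_boot all_order all_algebra.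
From mathcomp Require Import complex.
From mathcomp Require Import ring lra.
From mathcomp Require Import all_classical all_reals all_analysis.

Set Implicit Arguments.
Unset Strict Implicit.
Unset Printing Implicit Defensive.

Import Order.TTheory GRing.Theory Num.Theory.
Import numFieldNormedType.Exports.

Local Open Scope classical_set_scope.
Local Open Scope ring_scope.

(* Weak amenability makes the products [a b] span a dense subspace of [A].  For a
   closed ideal [I], let [J] be the closed span of [A I] and [I A]; density gives
   that [J] is also the closed span of [A J] and [J A], so every derivation
   [A -> J^*] is inner.  Given a derivation [D : A -> I^*], its restriction to [J]
   is implemented by some [phi] in [J^*]; by Hahn-Banach [phi] extends to [psi] in
   [I^*], and subtracting the inner derivation of [psi] leaves a derivation whose
   values vanish on [J].  Such a derivation vanishes on products, hence on [A]. *)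

(** * Subspaces and bounded linear maps *)

Definition linear_subspace (K : pzRingType) (V : lmodType K) (N : set V) :=
  N 0 /\ forall k x y, N x -> N y -> N (k *: x + y).

Lemma bounded_linear_map_continuous (K : numFieldType) (U V : normedModType K)
    (f : U -> V) (C : K) :
  linear f -> 0 <= C -> (forall x, `|f x| <= C * `|x|) -> continuous f.
Proof.
move=> fl C0 fC.
pose L := GRing.isLinear.Build K U V _ f fl.
pose f' : {linear U -> V} := HB.pack f L.
rewrite -[f]/(f' : U -> V).
apply: bounded_linear_continuous; apply/linear_boundedP.
near=> r => x; apply: le_trans (fC x) _; rewrite ler_wpM2r//.
by near: r; apply: nbhs_pinfty_ge; rewrite ger0_real.
Unshelve. all: by end_near. Qed.

(** * The Hahn-Banach theorem, first over the reals, then over the complex numbers *)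

Section hahn_banach.
Context {R : realType}.

Section real.
Context {V : lmodType R}.
Variable p : V -> R.
Hypothesis pD : forall x y, p (x + y) <= p x + p y.
Hypothesis pZ : forall k x, 0 <= k -> p (k *: x) = k * p x.

Let dominated (G : set (V * R^o)) := forall z, G z -> z.2 <= p z.1.

Let p0 : p 0 = 0.
Proof. by have := pZ 0 (lexx 0); rewrite scale0r mul0r. Qed.

(** Subadditivity puts each [z.2 - p (z.1 - v)] below each [p (w.1 + v) - w.2], for [z] and [w] in
    [G]; the supremum of the former is an admissible value at [v]. *)
Lemma dominated_extension (G : set (V * R^o)) (v : V) :
  linear_subspace G -> dominated G -> exists (c : R) (G' : set (V * R^o)),
    [/\ G `<=` G', G' (v, c), linear_subspace G' & dominated G'].
Proof.
move=> [] G0 GL Gp.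
pose S := [set z.2 - p (z.1 - v) | z in G].
have GD z w : G z -> G w -> G (z + w).
  by move=> Gz Gw; rewrite -[z]scale1r; exact: GL.
have Sub z : G z -> ubound S (p (z.1 + v) - z.2).
  move=> Gz _ [w Gw <-]; have := Gp _ (GD _ _ Gw Gz).
  have := pD (w.1 - v) (z.1 + v); rewrite addrACA addNr addr0 /=; lra.
have S0 : S !=set0 by exists (0 - p (0 - v)), (0, 0).
have Ssup : has_sup S by split=> //; exists (p (0 + v) - 0); exact: (Sub (0, 0)).
pose c := sup S.
have cl z : G z -> z.2 - p (z.1 - v) <= c.
  by move=> Gz; apply: sup_upper_bound => //; exists z.
have cr z : G z -> c <= p (z.1 + v) - z.2 by move=> /Sub; exact: ge_sup.
exists c, [set w | exists2 z, G z & exists k : R, w = z + k *: ((v, c) : V * R^o)].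
split.
- by move=> z Gz; exists z => //; exists 0; rewrite scale0r addr0.
- by exists 0 => //; exists 1; rewrite scale1r add0r.
- split; first by exists 0 => //; exists 0; rewrite scale0r addr0.
  move=> k _ _ [z Gz [a ->]] [w Gw [b ->]]; exists (k *: z + w); first exact: GL.
  by exists (k * a + b); rewrite scalerDr scalerA addrACA scalerDl.
move=> _ [z Gz [k ->]]; rewrite [leLHS](_ : _ = z.2 + k * c)//=.
have GZ a : G (a *: z) by have := GL a _ _ Gz G0; rewrite addr0.
(* Dividing by [|k|] reduces to [k = 1], which is the upper bound on [c], or to [k = -1], which is
   the lower bound. *)
have [k0|k0|<-] := ltgtP 0 k; last by rewrite scale0r mul0r !addr0; exact: Gp.
- have := cr _ (GZ k^-1); rewrite -(ler_pM2l k0) mulrBr -(pZ _ (ltW k0)) /=.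
  rewrite scalerDr !scalerA [k * (_ *: _)]mulrA mulfV ?gt_eqF// mul1r !scale1r.
  lra.
have nk0 : 0 < - k by rewrite oppr_gt0.
have := cl _ (GZ (- k)^-1); rewrite -(ler_pM2l nk0) mulrBr -(pZ _ (ltW nk0)) /=.
rewrite scalerBr !scalerA [- k * (_ *: _)]mulrA mulfV ?gt_eqF// mul1r !scale1r.
rewrite scaleNr opprK; lra.
Qed.

(* A partial functional is represented by its graph, a subspace of [V * R]. *)
Lemma real_hahn_banach (G0 : set (V * R^o)) :
  linear_subspace G0 -> dominated G0 ->
  exists f : V -> R^o, [/\ linear f, forall x, f x <= p x &
    forall z, G0 z -> f z.1 = z.2].
Proof.
move=> G0s G0p.
(* Zorn also ranges over the empty chain, whose union is empty; adjoining [G0] keeps [P] true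
   there. *)
pose P (A : set (V * R^o)) := linear_subspace (G0 `|` A) /\ dominated (G0 `|` A).
have [F FP Ftot|A [[As Ap] Amax]] := @Zorn_bigcup _ P.
  split; last first.
    by move=> z [/G0p//|[X FX Xz]]; apply: (FP _ FX).2; right.
  split; first by left; exact: G0s.1.
  have inF X z : F X -> (G0 `|` X) z -> (G0 `|` \bigcup_(Y in F) Y) z.
    by move=> FX [|]; [left|right; exists X].
  move=> k z w [G0z|[X FX Xz]] [G0w|[Y FY Yw]].
  - by left; exact: G0s.2.
  - by apply: (inF Y) => //; apply: (FP _ FY).1.2; [left|right].
  - by apply: (inF X) => //; apply: (FP _ FX).1.2; [right|left].
  have [XY|YX] := Ftot _ _ FX FY.
    by apply: (inF Y) => //; apply: (FP _ FY).1.2; right => //; exact: XY.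
  by apply: (inF X) => //; apply: (FP _ FX).1.2; right => //; exact: YX.
pose G := G0 `|` A.
have Gtot v : exists c : R^o, G (v, c).
  have [c [G' [GG' G'v G's G'p]]] := dominated_extension v As Ap.
  (* If [(v, c)] were not in [A], then [G'] would be a strictly larger set satisfying [P]. *)
  exists c; right; apply: contrapT => nAv.
  apply: (Amax G'); first by split; [move=> z Az; apply: GG'; right|move=> /(_ _ G'v)].
  by rewrite /P (_ : G0 `|` G' = G')//; apply/setUidPr => z G0z; apply: GG'; left.
(* a dominated subspace is a graph, as it contains no vertical line *)
have Gfun v (c d : R^o) : G (v, c) -> G (v, d) -> c <= d.
  move=> Gc Gd; have := As.2 (-1) _ _ Gd Gc => /Ap /=.
  by rewrite !scaleN1r addNr p0 addrC subr_le0.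
have [f Gf] := choice Gtot.
have Ginj v (c : R^o) : G (v, c) -> f v = c.
  by move=> Gc; apply/le_anti; rewrite !(Gfun v).
exists f; split.
- by move=> k x y; apply: Ginj; exact: (As.2 k _ _ (Gf x) (Gf y)).
- by move=> x; exact: Ap (Gf x).
- by move=> [x r] G0z; apply: Ginj; left.
Qed.

End real.

(** A type alias, so that the real scalar action does not clash with the complex one on [V]. *)
Definition restrict_scalars (V : lmodType R[i]) : Type := V.

Section restrict_scalars.
Variable V : lmodType R[i].
HB.instance Definition _ := GRing.Zmodule.on (restrict_scalars V).

Let rscale (k : R) (x : restrict_scalars V) : restrict_scalars V :=
  (k%:C)%C *: (x : V).
Let rscaleA a b x : rscale a (rscale b x) = rscale (a * b) x.
Proof. by rewrite /rscale scalerA -rmorphM. Qed.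
Let rscale1 : left_id 1 rscale.
Proof. by move=> x; rewrite /rscale scale1r. Qed.
Let rscaleDr : right_distributive rscale +%R.
Proof. by move=> k x y; rewrite /rscale scalerDr. Qed.
Let rscaleDl x : {morph rscale^~ x : a b / a + b}.
Proof. by move=> a b; rewrite /rscale rmorphD scalerDl. Qed.

HB.instance Definition _ := GRing.Zmodule_isLmodule.Build R (restrict_scalars V)
  rscaleA rscale1 rscaleDr rscaleDl.

Lemma restrict_scaleE (k : R) (x : restrict_scalars V) :
  k *: x = (k%:C)%C *: (x : V).
Proof. by []. Qed.
End restrict_scalars.

(** The real parts of [G] form a dominated real graph; its real extension [g] is the real part of a
    unique complex linear functional, [x |-> g x - i g (i x)]. *)
Lemma hahn_banach (V : normedModType R[i]) (G : set (V * R[i]^o)) (C : R[i]) :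
  0 <= C -> linear_subspace G -> (forall z, G z -> `|z.2| <= C * `|z.1|) ->
  exists f : dual_space V, forall z, G z -> f z.1 = z.2.
Proof.
move=> C0 [G0 GL] GC.
pose p (x : restrict_scalars V) : R := complex.Re (C * `|x : V|).
have pE x : ((p x)%:C)%C = C * `|x : V|.
  by rewrite RRe_real// ger0_real// mulr_ge0.
have pD x y : p (x + y) <= p x + p y.
  by rewrite -lecR rmorphD /= !pE -mulrDr ler_wpM2l// ler_normD.
have pZ k x : 0 <= k -> p (k *: x) = k * p x.
  move=> k0; apply: (@complexI R); rewrite rmorphM /= !pE restrict_scaleE normrZ.
  by rewrite ger0_norm ?ler0c// mulrCA.
pose GR : set (restrict_scalars V * R^o) :=
  [set (z.1, complex.Re z.2) | z in G].
have GRs : linear_subspace GR.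
  split; first by exists 0.
  move=> k _ _ [z Gz <-] [w Gw <-]; exists ((k%:C)%C *: z + w); first exact: GL.
  case: z w {Gz Gw} => [z [a b]] [w [c d]].
  by congr pair => /=; rewrite mul0r subr0.
have GRp z : GR z -> z.2 <= p z.1.
  move=> [{}z Gz <-] /=; rewrite -lecR pE; apply: le_trans (GC _ Gz).
  case: z {Gz} => [z [a b]] /=; rewrite normc_def /= lecR.
  by rewrite (le_trans (ler_norm a))// -sqrtr_sqr ler_wsqrtr// lerDl sqr_ge0.
have [g [gl gp gG]] := real_hahn_banach pD pZ GRs GRp.
have gD (x y : V) : g (x + y : V) = g x + g y.
  by have := gl 1 x y; rewrite !scale1r.
have g0 : g 0 = 0 by apply: (addrI (g 0)); rewrite -gD !addr0.
have gZ (k : R) x : g ((k%:C)%C *: (x : V)) = k * g x.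
  by have := gl k x 0; rewrite g0 !addr0.
pose f (x : V) : R[i]^o := (g x -i* g ('i%C *: x))%C.
have fl : linear f.
  move=> [a b] x y.
  have gab (u : V) : g ((a +i* b)%C *: u) = a * g u + b * g ('i%C *: u).
    rewrite -!gZ -gD scalerA -scalerDl; congr (g (_ *: (_ : V))).
    by apply/eqP; rewrite eq_complex /=; apply/andP; split; apply/eqP; ring.
  have gii (u : V) : g ('i%C *: ('i%C *: u)) = - g u.
    rewrite scalerA -[RHS]mulN1r -gZ; congr (g (_ *: (_ : V))).
    by apply/eqP; rewrite eq_complex /=; apply/andP; split; apply/eqP; ring.
  rewrite /f scalerDr !gD scalerA [_%C * (_ +i* _)%C]mulrC -scalerA !gab gii.
  by apply/eqP; rewrite eq_complex /=; apply/andP; split; apply/eqP; ring.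
have gle x : `|g x| <= p x.
  rewrite ler_norml gp andbT lerNl -[- g x]mulN1r -gZ.
  apply: le_trans (gp _) _; rewrite -lecR !pE normrZ.
  by rewrite normc_def /= expr0n /= addr0 sqrrN expr1n sqrtr1 mul1r.
(* The factor 2 comes from bounding [g x] and [g (i x)] separately; it is harmless because only
   continuity is needed. *)
have fC x : `|f x| <= (C *+ 2) * `|x|.
  have fE : f x = ((g x)%:C)%C - 'i%C * ((g ('i%C *: x))%:C)%C.
    by apply/eqP; rewrite eq_complex /=; apply/andP; split; apply/eqP; ring.
  have nr (a : R) : `|(a%:C)%C| = (`|a|%:C)%C.
    by rewrite normc_def /= expr0n/= addr0 sqrtr_sqr.
  have ni : `|'i%C : R[i]| = 1.
    by rewrite normc_def /= expr0n/= add0r expr1n sqrtr1.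
  rewrite fE (le_trans (ler_normB _ _))// normrM ni mul1r !nr mulr2n mulrDl.
  apply: lerD; first by rewrite -pE lecR.
  by rewrite -[X in C * X]mul1r -ni -normrZ -pE lecR.
have fc : continuous f.
  by apply: (bounded_linear_map_continuous fl _ fC); rewrite mulrn_wge0.
exists (DualFunctional fl fc) => z Gz /=.
have G1 : GR (z.1, complex.Re z.2) by exists z.
(* [G] is stable under multiplication by [i], and the real part of [i z.2] is minus the imaginary
   part of [z.2]. *)
have Gi : GR ('i%C *: z.1, complex.Re ('i%C * z.2)).
  by exists ('i%C *: z) => //; rewrite -[X in G X]addr0; exact: GL.
rewrite /f (gG _ G1) (gG _ Gi); case: (z.2) => a b /=.
by apply/eqP; rewrite eq_complex /=; apply/andP; split; apply/eqP; ring.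
Qed.

End hahn_banach.

(** * Closed linear spans *)

Lemma linear_subspaceZ (K : pzRingType) (V : lmodType K) (N : set V) k x :
  linear_subspace N -> N x -> N (k *: x).
Proof. by move=> [N0 NL] Nx; have := NL k x 0 Nx N0; rewrite addr0. Qed.

Lemma linear_subspace_sum (K : pzRingType) (V : lmodType K) (N : set V) n (F : 'I_n -> V) :
  linear_subspace N -> (forall i, N (F i)) -> N (\sum_(i < n) F i).
Proof.
move=> [N0 NL] NF; apply: big_ind => // x y Nx Ny.
by rewrite -[x]scale1r; exact: NL.
Qed.

Lemma linear_span_linear_subspace (K : numFieldType) (V : lmodType K) (S : set V) :
  linear_subspace (linear_span S).
Proof.
split.
  exists 0%N, (fun=> 0), (fun=> 0).
  by split; [case|rewrite big_ord0].
move=> k _ _ [n [c [s [Ss ->]]]] [m [d [t [St ->]]]].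
exists (n + m)%N.
exists (fun i => match fintype.split i with inl j => k * c j | inr j => d j end).
exists (fun i => match fintype.split i with inl j => s j | inr j => t j end).
split; first by move=> i; case: fintype.split.
rewrite big_split_ord /= scaler_sumr; congr (_ + _); apply: eq_bigr => i _.
  by rewrite (unsplitK (inl i)) scalerA.
by rewrite (unsplitK (inr i)).
Qed.

Lemma closure_linear_subspace (K : numFieldType) (V : normedModType K) (N : set V) :
  linear_subspace N -> linear_subspace (closure N).
Proof.
move=> [N0 NL]; split; first exact: subset_closure.
move=> k x y Nx Ny B /= Bxy.
have : (fun z : V * V => k *: z.1 + z.2) @ (x, y) --> k *: x + y.
  apply: cvgD; last exact: cvg_snd.
  by apply: cvgZl_tmp; exact: cvg_fst.
move=> /(_ _ Bxy)[[P Q]] /= [Px Qy] PQB.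
have [u [Nu Pu]] := Nx _ Px; have [v [Nv Qv]] := Ny _ Qy.
by exists (k *: u + v); split; [exact: NL|exact: (PQB (u, v))].
Qed.

Section closed_linear_span.
Context {K : numFieldType} {V : normedModType K}.
Implicit Types (S N : set V).

Lemma sub_closed_linear_span S : S `<=` closed_linear_span S.
Proof.
move=> x Sx; apply: subset_closure.
exists 1%N, (fun=> 1), (fun=> x); split=> //.
by rewrite big_ord1 scale1r.
Qed.

Lemma closed_linear_span_linear_subspace S : linear_subspace (closed_linear_span S).
Proof. exact/closure_linear_subspace/linear_span_linear_subspace. Qed.

Lemma closed_linear_span_sub S N :
  linear_subspace N -> closed N -> S `<=` N -> closed_linear_span S `<=` N.
Proof.
move=> Ns Nc SN; rewrite [X in _ `<=` X](closure_id N).1//.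
apply: closure_subset => _ [n [c [s [Ss ->]]]].
by apply: linear_subspace_sum => // i; apply: linear_subspaceZ => //; exact: SN.
Qed.

(** The preimage of [N] under [f] is a closed subspace containing [S]. This carries statements about
    products over to all of [A] by density. *)
Lemma closed_linear_span_linear (W : normedModType K) S (N : set W) (f : V -> W) :
  linear f -> continuous f -> linear_subspace N -> closed N ->
  (forall x, S x -> N (f x)) -> forall x, closed_linear_span S x -> N (f x).
Proof.
move=> fl fc [N0 NL] Nc SN; apply: (@closed_linear_span_sub _ (f @^-1` N)) => //.
  split=> [|k x y Nx Ny] /=; last by rewrite fl; exact: NL.
  by have := fl (-1) 0 0; rewrite scaler0 addr0 scaleN1r addNr => ->.
by apply: preimage_closed => // x _; exact: fc.
Qed.

End closed_linear_span.

(** * Separation and extension of continuous functionals *)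

(** Extend [x + k v |-> k] from the span of [N] and [v]. If the ball of radius [d] around [v] misses
    [N], then [|x + k v| = |k| |v + x / k| >= d |k|], so [1 / d] bounds this functional. *)
Lemma hahn_banach_separation (R : realType) (V : normedModType R[i])
    (N : set V) (v : V) :
  linear_subspace N -> closed N -> ~ N v ->
  exists f : dual_space V, (forall x, N x -> f x = 0) /\ f v = 1.
Proof.
move=> Ns Nc Nv.
have /nbhs_ballP[d /= d0 dN] : nbhs v (~` N).
  by apply: open_nbhs_nbhs; split=> //; exact: closed_openC.
pose G : set (V * R[i]^o) := [set (x + k *: v, k) | x in N & k in setT].
have [|||f fG] := @hahn_banach R V G d^-1; first by rewrite invr_ge0 ltW.
- split; first by exists 0; [exact: Ns.1|exists 0 => //; rewrite scale0r addr0].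
  move=> k _ _ [x Nx [a _ <-]] [y Ny [b _ <-]].
  exists (k *: x + y); first exact: Ns.2; exists (k * a + b) => //.
  by congr pair; rewrite /= scalerDr scalerA addrACA scalerDl.
- move=> _ [x Nx [k _ <-]] /=; have [->|k0] := eqVneq k 0.
    by rewrite (@normr0 _ R[i]^o) mulr_ge0 // invr_ge0 ltW.
  rewrite ler_pdivlMl// mulrC -ler_pdivlMl ?normr_gt0// -normfV -normrZ.
  rewrite scalerDr scalerA mulVf// scale1r real_leNgt ?normr_real// ?gtr0_real//.
  apply/negP => kv; apply: (dN (- (k^-1 *: x))).
    by rewrite -ball_normE /= opprK addrC.
  by rewrite -scaleNr; exact: linear_subspaceZ.
exists f; split=> [x Nx|].
  by apply: (fG (x, 0)); exists x => //; exists 0 => //; rewrite scale0r addr0.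
apply: (fG (v, 1)); exists 0; first exact: Ns.1.
by exists 1 => //; rewrite scale1r add0r.
Qed.

(** Since [|g w| <= C |w| <= C |f w|], the pairs [(f w, g w)] form a bounded graph. Using a map [f]
    instead of a subset suits ideals, which are types of their own. *)
Lemma hahn_banach_ext (R : realType) (V W : normedModType R[i]) (f : W -> V) :
  linear f -> (forall w, `|w| <= `|f w|) ->
  forall g : dual_space W, exists h : dual_space V, forall w, h (f w) = g w.
Proof.
move=> fl fn g; have [C C0 gC] := dual_bounded g.
pose G : set (V * R[i]^o) := range (fun w => (f w, g w : R[i]^o)).
have [|||h hG] := @hahn_banach R V G C; first exact: ltW.
- split.
    exists 0 => //; congr pair; last exact: linear0.
    by have := fl (-1) 0 0; rewrite scaler0 addr0 scaleN1r addNr.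
  move=> k _ _ [x _ <-] [y _ <-]; exists (k *: x + y) => //.
  by congr pair; [exact: fl|rewrite linearP].
- by move=> _ [w _ <-] /=; rewrite (le_trans (gC w))// ler_wpM2l// ltW.
by exists h => w; apply: (hG (f w, g w)); exists w.
Qed.

(** * Continuity of the actions and density of products *)

Section bimodule_continuity.
Context {K : numFieldType} {A : banachAlgType K} (X : banach_bimodule A).

Lemma lactl_continuous (x : X) : continuous (fun a : A => lact a x).
Proof.
move=> a; apply: (@continuous_comp _ _ _ (fun a => (a, x)) (fun z => lact z.1 z.2)).
  by apply: cvg_pair => /=; [exact: cvg_id|exact: cvg_cst].
exact: lact_continuous.
Qed.

Lemma ractr_continuous (x : X) : continuous (fun a : A => ract x a).
Proof.
move=> a; apply: (@continuous_comp _ _ _ (fun a => (x, a)) (fun z => ract z.1 z.2)).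
  by apply: cvg_pair => /=; [exact: cvg_cst|exact: cvg_id].
exact: ract_continuous.
Qed.

End bimodule_continuity.

(* If [f] vanishes on all products, then [a |-> f a *: f] is a derivation; being
   inner, it sends [a] to a functional vanishing at [a], that is [f a ^+ 2 = 0]. *)
Lemma weakly_amenable_dense_products (R : realType) (A : banachAlgType R[i]) :
  weakly_amenable A ->
  forall a : A, closed_linear_span [set amul b c | b in setT & c in setT] a.
Proof.
move=> wA a; apply: contrapT => Na.
have [f [fN fa]] := hahn_banach_separation
  (closed_linear_span_linear_subspace _) (@closed_closure _ _) Na.
have f0 b c : f (amul b c) = 0.
  by apply: fN; apply: sub_closed_linear_span; exists b => //; exists c.
pose D (b : A) : dual_bimodule (regular_bimodule A) := (f b : R[i]) *: f.
have [|phi Dphi] := wA D.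
  split.
  - by move=> k x y; rewrite /D linearP scalerDl scalerA.
  - move=> x; apply: cvgZr_tmp; exact: dual_continuous.
  - move=> b c; apply: dualP => x.
    by rewrite /D f0 scale0r /= !f0 !scaler0 addr0.
(* At [a] both actions on [phi] give [phi (amul a a)]; the factor [-1] is how negation in the dual
   unfolds. *)
have faa : f a * f a = phi (amul a a) + -1 * phi (amul a a).
  by have := congr1 (fun h : dual_space A => h a) (Dphi a).
by move: faa; rewrite fa !mul1r mulN1r subrr => /eqP; rewrite oner_eq0.
Qed.

(** * The closed span of [A I] and [I A], and restriction of functionals to it *)

Section ideal_core.
Context {R : realType} {A : banachAlgType R[i]}.
Variable I : closed_ideal A.

Lemma ideal_linear_subspace : linear_subspace (I : set A).
Proof. by split; [exact: ideal0|move=> k x y; exact: ideal_linear]. Qed.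

Let J := closed_linear_span (ideal_products I).

Let J_sub : linear_subspace J.
Proof. exact: closed_linear_span_linear_subspace. Qed.

Lemma ideal_core_sub : J `<=` I.
Proof.
apply: closed_linear_span_sub; [exact: ideal_linear_subspace|exact: ideal_closed|].
by move=> _ [[a _ [x Ix <-]]|[a _ [x Ix <-]]]; [exact: ideal_mull|exact: ideal_mulr].
Qed.

(** As [J] lies in [I], such a product is already one of the generators of [J]. *)
Let J_mull a x : J x -> J (amul a x).
Proof.
by move=> /ideal_core_sub Ix; apply: sub_closed_linear_span; left; exists a => //; exists x.
Qed.

Let J_mulr a x : J x -> J (amul x a).
Proof.
by move=> /ideal_core_sub Ix; apply: sub_closed_linear_span; right; exists a => //; exists x.
Qed.

Definition ideal_core : closed_ideal A :=
  @ClosedIdeal R[i] A J J_sub.1 J_sub.2 J_mull J_mulr (@closed_closure _ _).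

Lemma ideal_core_mull a x : (I : set A) x -> (ideal_core : set A) (amul a x).
Proof. by move=> Ix; apply: sub_closed_linear_span; left; exists a => //; exists x. Qed.

Lemma ideal_core_mulr a x : (I : set A) x -> (ideal_core : set A) (amul x a).
Proof. by move=> Ix; apply: sub_closed_linear_span; right; exists a => //; exists x. Qed.

(** For a generator [a x] with [x] in [I], density allows [a] to be replaced by products [b c]; then
    [(b c) x = b (c x)] with [c x] already in the core. The other side is symmetric. *)
Lemma ideal_core_idem : weakly_amenable A ->
  (ideal_core : set A) = closed_linear_span (ideal_products ideal_core).
Proof.
move=> wA; have dense := weakly_amenable_dense_products wA.
have Ns := closed_linear_span_linear_subspace (ideal_products ideal_core).
have Nc : closed (closed_linear_span (ideal_products ideal_core)).
  exact: closed_closure.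
apply/seteqP; split; last first.
  apply: closed_linear_span_sub; [exact: J_sub|exact: closed_closure|].
  by move=> _ [[a _ [x Jx <-]]|[a _ [x Jx <-]]]; [exact: J_mull|exact: J_mulr].
apply: closed_linear_span_sub => // _ [] [a _ [x Ix <-]].
  apply: (closed_linear_span_linear (f := fun b => amul b x)) (dense a) => //.
  - exact: amul_linearl.
  - exact: (@lactl_continuous _ _ (regular_bimodule A)).
  move=> _ [b _ [c _ <-]]; rewrite -amulA; apply: sub_closed_linear_span; left.
  by exists b => //; exists (amul c x) => //; exact: ideal_core_mull.
apply: (closed_linear_span_linear (f := fun b => amul x b)) (dense a) => //.
- exact: amul_linearr.
- exact: (@ractr_continuous _ _ (regular_bimodule A)).
move=> _ [b _ [c _ <-]]; rewrite amulA; apply: sub_closed_linear_span; right.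
by exists c => //; exists (amul x b) => //; exact: ideal_core_mulr.
Qed.

Definition ideal_core_incl (x : ideal_space ideal_core) : ideal_space I :=
  IdealSpace (mem_set (ideal_core_sub (set_mem (ideal_valP x)))).

Lemma ideal_core_incl_linear : linear ideal_core_incl.
Proof. by move=> k x y; exact: val_inj. Qed.

Lemma ideal_core_incl_continuous : continuous ideal_core_incl.
Proof.
apply: (bounded_linear_map_continuous ideal_core_incl_linear ler01) => x.
by rewrite mul1r.
Qed.

Let restr_linear (f : dual_space (ideal_space I)) :
  linear (fun x => f (ideal_core_incl x)).
Proof. by move=> k x y; rewrite ideal_core_incl_linear linearP. Qed.

Let restr_continuous (f : dual_space (ideal_space I)) :
  continuous (fun x => f (ideal_core_incl x)).
Proof.
move=> x; apply: (@continuous_comp _ _ _ ideal_core_incl f).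
  exact: ideal_core_incl_continuous.
exact: dual_continuous.
Qed.

(** The adjoint of the inclusion of the core into [I]. *)
Definition ideal_core_restr (f : dual_space (ideal_space I)) :
    dual_space (ideal_space ideal_core) :=
  DualFunctional (@restr_linear f) (@restr_continuous f).

Lemma ideal_core_restr_linear : linear ideal_core_restr.
Proof. by move=> k f g; exact: dualP. Qed.

Lemma ideal_core_restr_continuous : continuous ideal_core_restr.
Proof.
apply: (bounded_linear_map_continuous ideal_core_restr_linear ler01) => f.
rewrite mul1r dual_normE; apply: opnorm_le => // x.
exact: (opnorm_bound f (ideal_core_incl x)).
Qed.

(** Restriction is a bounded bimodule map, because the inclusion commutes with both actions up to
    membership proofs. *)
Lemma ideal_core_restr_derivation (D : A -> dual_bimodule (ideal_bimodule I)) :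
  derivation D ->
  derivation (ideal_core_restr \o D : A -> dual_bimodule (ideal_bimodule ideal_core)).
Proof.
move=> [Dl Dc DM]; split.
- by move=> k a b /=; rewrite Dl; exact: ideal_core_restr_linear.
- move=> a; apply: (@continuous_comp _ _ _ D ideal_core_restr); first exact: Dc.
  exact: ideal_core_restr_continuous.
- move=> a b; apply: dualP => x /=; rewrite DM /=.
  by congr (D _ _ + D _ _); exact: val_inj.
Qed.

(* A derivation into [I^*] killing [ideal_core] is zero on products since
   [a . D b] and [D a . b] only involve values of [D] on [ideal_core]. *)
Lemma derivation_ideal_core0 (D : A -> dual_bimodule (ideal_bimodule I)) :
  weakly_amenable A -> derivation D -> (forall a, ideal_core_restr (D a) = 0) ->
  forall a, D a = 0.
Proof.
move=> wA [Dl Dc DM] DJ a.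
have DJE b (x : ideal_space I) : (ideal_core : set A) (ideal_val x) -> (D b : dual_space _) x = 0.
  move=> Jx; have := congr1 (fun h : dual_space _ => h (IdealSpace (mem_set Jx))) (DJ b).
  by move=> /= <-; congr (D b _); exact: val_inj.
(* The zero subspace is closed, so by density it is enough that [D] vanishes on products. *)
have Z0 : linear_subspace [set (0 : dual_space (ideal_space I))].
  by split=> [//|k x y -> ->]; rewrite scaler0 addr0.
have Zc : closed [set (0 : dual_space (ideal_space I))].
  exact/accessible_closed_set1/hausdorff_accessible/norm_hausdorff.
have dense := weakly_amenable_dense_products wA.
apply: (closed_linear_span_linear Dl Dc Z0 Zc _ (dense a)) => _ [b _ [c _ <-]].
rewrite DM; apply: dualP => x /=; rewrite !DJE ?addr0//=.
  exact/ideal_core_mull/set_mem/ideal_valP.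
exact/ideal_core_mulr/set_mem/ideal_valP.
Qed.

End ideal_core.

(** * Inner derivations, differences of derivations, and the conclusion *)

Section derivations.
Context {K : numFieldType} {A : banachAlgType K} (X : banach_bimodule A).

Let linear_mapB (U V : lmodType K) (f : U -> V) x y :
  linear f -> f (x - y) = f x - f y.
Proof. by move=> fl; rewrite -scaleN1r addrC fl scaleN1r addrC. Qed.

(** In the product rule the mixed terms [a . (x . b)] and [(a . x) . b] cancel. *)
Lemma inner_is_derivation (x : X) : derivation (fun a => lact a x - ract x a).
Proof.
split.
- move=> k a b; rewrite lact_linearl ract_linearr scalerBr opprD.
  by rewrite addrACA.
- move=> a; apply: cvgB; [exact: lactl_continuous|exact: ractr_continuous].
move=> a b; rewrite (linear_mapB _ _ (@lact_linearr _ _ X a)).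
rewrite (linear_mapB _ _ (@ract_linearl _ _ X b)) lactA ractA lractA.
by rewrite addrA subrK.
Qed.

Lemma derivationB (D E : A -> X) :
  derivation D -> derivation E -> derivation (fun a => D a - E a).
Proof.
move=> [Dl Dc DM] [El Ec EM]; split.
- by move=> k a b; rewrite Dl El scalerBr opprD addrACA.
- by move=> a; apply: cvgB; [exact: Dc|exact: Ec].
move=> a b; rewrite (linear_mapB _ _ (@lact_linearr _ _ X a)).
by rewrite (linear_mapB _ _ (@ract_linearl _ _ X b)) DM EM opprD addrACA.
Qed.

End derivations.

Theorem theorem1p5 (R : realType) (A : banachAlgType R[i])
    (A_weakly_amenable : weakly_amenable A)
    (A_ideal_weakly_amenable : forall I : closed_ideal A,
      (I : set A) = closed_linear_span (ideal_products I) ->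
      ideal_weakly_amenable I) :
  ideally_amenable A.
Proof.
move=> I D Dder.
have [phi Dphi] := A_ideal_weakly_amenable _ (ideal_core_idem I A_weakly_amenable)
  _ (ideal_core_restr_derivation Dder).
(* Both ideals carry the norm of [A], so the inclusion is isometric and reflexivity gives the norm
   hypothesis. *)
have [psi psiE] := hahn_banach_ext (@ideal_core_incl_linear _ _ I)
  (fun x => lexx `|x|) phi.
pose X := dual_bimodule (ideal_bimodule I).
pose D' a : X := D a - (@lact _ _ X a psi - @ract _ _ X psi a).
exists psi => a; apply/eqP; rewrite -subr_eq0; apply/eqP.
apply: (@derivation_ideal_core0 _ _ _ D') => // [|b].
  exact: derivationB Dder (inner_is_derivation _).
apply: dualP => x.
have := congr1 (fun h : dual_space _ => h x) (Dphi b).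
rewrite /= => ->; rewrite -!psiE.
(* Moving the actions outside the inclusion makes the two inner derivations, of [phi] and of [psi],
   agree on the core. *)
have -> : ideal_core_incl (ideal_ract x b) = ideal_ract (ideal_core_incl x) b.
  exact: val_inj.
have -> : ideal_core_incl (ideal_lact b x) = ideal_lact b (ideal_core_incl x).
  exact: val_inj.
by rewrite [X in _ + X = _]scaleN1r subrr.
Qed.
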